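(* Let $P(x)$ be any Laurent polynomial (with complex coefficients) and let $k$ be a positive integer. For integers $n\ge 0$ and $0\le a<k$ define $$A(n,k,a):=\sum_{j=-\infty}^{\infty}\binom{n}{kj+a}_P,$$ where $\binom{n}{m}_P$ denotes the coefficient of $x^m$ in $P(x)^n$, and define the generating functions $$f_{k,a}(t):=\sum_{n=0}^{\infty}A(n,k,a)\,t^n\qquad(0\le a<k).$$ Then the $f_{k,a}(t)$, $0\le a<k$, are rational functions of $t$, all with the same denominator, of degree $k$ in $t$; that is, there are a polynomial $D(t)$ of degree $k$ (not depending on $a$) and polynomials $N_0(t),\dots,N_{k-1}(t)$ such that $f_{k,a}(t)=N_a(t)/D(t)$ for every $0\le a<k$. Equivalently, the $k$ sequences $\{A(n,k,a)\}_{n=0}^{\infty}$ ($0\le a\le k-1$) satisfy the same homogeneous linear recurrence equation with constant coefficients of order $k$; that is, there are constants $c_1,\dots,c_k$ (not depending on $a$ or $n$) such that $$A(n+k,k,a)=\sum_{i=1}^{k}c_i\,A(n+k-i,k,a)\qquad\text{for all } n\ge 0 \text{ and all } 0\le a<k.$$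
   Context: For a Laurent polynomial $P(x)$, an integer $n\ge 0$ and an integer $m$, the symbol $\binom{n}{m}_P$ denotes the coefficient of $x^m$ in $P(x)^n$ (with $P(x)^0=1$). For each $n$ only finitely many of these coefficients are nonzero, so the sum defining $A(n,k,a)$ is finite. The generating functions are formal power series in $t$. The common denominator is not required to be in lowest terms with respect to each individual numerator, and the recurrence coefficients (including $c_k$) are allowed to be zero. *)

(* Defs.v *)
From HB Require Import structures.
From mathcomp Require Import all_boot all_order all_algebra.
From mathcomp Require Import finmap classical_sets fsbigop reals.
From mathcomp Require Import complex.
From mathcomp Require Import monalg.

Set Implicit Arguments.
Unset Strict Implicit.
Unset Printing Implicit Defensive.

Import GRing.Theory.
Local Open Scope fset_scope.
Local Open Scope ring_scope.

(* Laurent polynomials are the finitely supported functions int -> K, where   *)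
(* P@_m is the coefficient of x^m. [monalg] supplies the additive structure   *)
(* but not the product, because its ring instance requires an exponent monoid *)
(* without nontrivial invertible elements, which excludes int.                *)
Definition laurent (K : comNzRingType) : predArgType := {malg K[int]}.

HB.instance Definition _ (K : comNzRingType) := GRing.Zmodule.on (laurent K).

Section LaurentRing.
Context (K : comNzRingType).
Implicit Types (P Q : laurent K).

Definition laurent_one : laurent K := << 1 *g (0 : int) >>.

Definition laurent_mul P Q : laurent K :=
  \sum_(i <- msupp P) \sum_(j <- msupp Q) << P@_i * Q@_j *g (i + j : int) >>.

Lemma laurent_mulEw (d1 d2 : {fset int}) P Q :
  msupp P `<=` d1 -> msupp Q `<=` d2 ->
  laurent_mul P Q =
    \sum_(i <- d1) \sum_(j <- d2) << P@_i * Q@_j *g (i + j : int) >>.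
Proof.
move=> le1 le2; rewrite /laurent_mul (big_fset_incl _ le1) /=.
  apply/eq_bigr=> i _; apply/big_fset_incl => // j _ /mcoeff_outdom ->.
  by rewrite mulr0 monalgU0.
move=> i _ /mcoeff_outdom Pi.
by rewrite big1 => // j _; rewrite Pi mul0r monalgU0.
Qed.

Lemma laurent_mulC : commutative laurent_mul.
Proof.
move=> P Q; rewrite /laurent_mul exchange_big; apply/eq_bigr => j _ /=.
by apply/eq_bigr => i _; rewrite mulrC addrC.
Qed.

Lemma laurent_mul0l : left_zero 0 laurent_mul.
Proof. by move=> P; rewrite /laurent_mul msupp0 big_seq_fset0. Qed.

Lemma laurent_mulDl : left_distributive laurent_mul +%R.
Proof.
move=> P1 P2 Q.
rewrite [in RHS](laurent_mulEw (fsubsetUl _ (msupp P2)) (fsubset_refl _)).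
rewrite [in RHS](laurent_mulEw (fsubsetUr (msupp P1) _) (fsubset_refl _)).
rewrite (laurent_mulEw (msuppD_le _ _) (fsubset_refl _)).
rewrite -big_split /=; apply/eq_bigr=> i _.
rewrite -big_split /=; apply/eq_bigr=> j _.
by rewrite mcoeffD mulrDl monalgUD.
Qed.

Lemma laurent_mulUg c (i : int) Q :
  laurent_mul << c *g i >> Q =
    \sum_(j <- msupp Q) << c * Q@_j *g (i + j : int) >>.
Proof.
rewrite (laurent_mulEw msuppU_le (fsubset_refl _)) big_seq_fset1.
by apply/eq_bigr => j _; rewrite mcoeffUU.
Qed.

Lemma laurent_mulUU c d (i j : int) :
  laurent_mul << c *g i >> << d *g j >> = << c * d *g (i + j : int) >>.
Proof.
by rewrite (laurent_mulEw msuppU_le msuppU_le) !big_seq_fset1 !mcoeffUU.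
Qed.

Lemma laurent_mul1l : left_id laurent_one laurent_mul.
Proof.
move=> P; rewrite /laurent_one laurent_mulUg [RHS]monalgE.
by apply/eq_bigr=> i _; rewrite mul1r add0r.
Qed.

Lemma laurent_mul_suml (I : Type) (r : seq I) (F : I -> laurent K) Q :
  laurent_mul (\sum_(i <- r) F i) Q = \sum_(i <- r) laurent_mul (F i) Q.
Proof.
exact: (big_morph (laurent_mul^~ Q) (fun _ _ => laurent_mulDl _ _ _)
  (laurent_mul0l _)).
Qed.

Lemma laurent_mul_sumr (I : Type) (r : seq I) (F : I -> laurent K) P :
  laurent_mul P (\sum_(i <- r) F i) = \sum_(i <- r) laurent_mul P (F i).
Proof.
rewrite laurent_mulC laurent_mul_suml.
by apply/eq_bigr => i _; rewrite laurent_mulC.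
Qed.

Lemma laurent_mulA : associative laurent_mul.
Proof.
move=> P Q S.
rewrite [P]monalgE !(laurent_mul_suml (msupp P)); apply/eq_bigr => i _.
rewrite [Q]monalgE (laurent_mul_suml (msupp Q)) !(laurent_mul_sumr (msupp Q)).
rewrite (laurent_mul_suml (msupp Q)); apply/eq_bigr => j _.
rewrite [S]monalgE !(laurent_mul_sumr (msupp S)); apply/eq_bigr => l _.
by rewrite !laurent_mulUU mulrA addrA.
Qed.

Lemma laurent_one_neq0 : laurent_one != 0.
Proof. by rewrite monalgU_eq0 oner_eq0. Qed.

HB.instance Definition _ := GRing.Zmodule_isComNzRing.Build (laurent K)
  laurent_mulA laurent_mulC laurent_mul1l laurent_mulDl laurent_one_neq0.

End LaurentRing.

Section GeneratingFunctions.
Context (K : comNzRingType).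

(* Generalized binomial coefficient: the coefficient of x^m in P(x)^n. *)
Definition laurent_binom (P : laurent K) (n : nat) (m : int) : K :=
  (P ^+ n)@_m.

(* The library's sum over an infinite set is the sum over the indices with a  *)
(* nonzero summand when these are finitely many (as is the case for k > 0)    *)
(* and 0 otherwise.                                                           *)
Definition multisection (P : laurent K) (n k a : nat) : K :=
  \sum_(j \in [set: int]) laurent_binom P n (k%:Z * j + a%:Z).

(* A formal power series is given by its sequence of coefficients. *)
Definition gen_fun (P : laurent K) (k a : nat) : nat -> K :=
  fun n => multisection P n k a.

Definition series_of_poly (p : {poly K}) : nat -> K := fun n => p`_n.

Definition series_mul (f g : nat -> K) : nat -> K :=
  fun n => \sum_(i < n.+1) f i * g (n - i)%N.

(* f = N / D as formal power series over a field; the quotient makes sense    *)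
(* because D(0) != 0 is exactly invertibility of D as a power series.         *)
Definition series_eq_ratio (f : nat -> K) (N D : {poly K}) : Prop :=
  D`_0 != 0 /\ series_mul (series_of_poly D) f =1 series_of_poly N.

End GeneratingFunctions.

(* Main.v *)
Require Import Defs.
From mathcomp Require Import all_boot all_order all_algebra.
From mathcomp Require Import ring zify.
From mathcomp Require Import finmap classical_sets fsbigop monalg.
From mathcomp Require Import reals complex.

(** Modulo [x^k - 1] a Laurent polynomial keeps exactly the sums of its
    coefficients over the residue classes of exponents, so the numbers
    [A(n,k,a)] are the coordinates of the image of [P^n] in the [k]-dimensional
    algebra [K[x]/(x^k - 1)].  That algebra is represented here by matrices:
    [x] acts as the cyclic shift of order [k], and evaluating [P] at this shift
    ([fold_mx]) gives a circulant matrix [M].  Evaluation is multiplicative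
    ([fold_mxM]), hence [A(n,k,a)] is the entry of row [a] in the first column
    of [M^n] ([multisectionE]).

    Every polynomial annihilating [M] therefore gives a linear recurrence
    shared by the [k] sequences ([multisection_recurrence]), and by
    Cayley-Hamilton the characteristic polynomial of [M] is one of order [k].

    For the generating functions, the denominator is the reversal of a
    recurrence polynomial ([rational_of_recurrence]).  Reversing the
    characteristic polynomial itself loses degree when [0] is an eigenvalue of
    [M].  Since a common factor of numerator and denominator does no harm, the
    factor [X^r] of the characteristic polynomial is first replaced by
    [(X - 1)^r] ([nonvanishing_at_0_replacement]): the new polynomial has the
    same degree and a nonzero constant term, and its recurrence holds from
    index [r] on, which only enlarges the numerators. *)

Import GRing.Theory.
Local Open Scope ring_scope.

(** * Laurent polynomials modulo x^k - 1 *)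

(** The [m]-th power, for any integer [m], of the permutation matrix of the
    cycle [b -> b + 1] on the residues modulo [k]. *)
Definition cyclic_shift_mx (K : comNzRingType) (k : nat) (m : int) : 'M[K]_k :=
  \matrix_(a, b) (k%:Z %| m + b%:Z - a%:Z)%Z%:R.

(** The value of [Q] at the cyclic shift, that is, the matrix of multiplication
    by [Q] on [K[x]/(x^k - 1)]. *)
Definition fold_mx (K : comNzRingType) (k : nat) (Q : laurent K) : 'M[K]_k :=
  \sum_(m <- msupp Q) Q@_m *: cyclic_shift_mx K k m.

Lemma ord_residue (k : nat) (m : int) :
  (0 < k)%N -> {c : 'I_k | forall b : 'I_k, (k%:Z %| m - b%:Z)%Z = (b == c)}.
Proof.
move=> k_gt0; have k_neq0 : k%:Z != 0 by rewrite eqz_nat -lt0n.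
have lt_c : (`|(m %% k)%Z| < k)%N.
  by rewrite -ltz_nat gez0_abs ?modz_ge0 // ltz_pmod.
exists (Ordinal lt_c) => b.
rewrite -eqz_mod_dvd (modz_small (m := b)) ?ltz_nat ?ltn_ord //.
by rewrite -val_eqE /= -eqz_nat gez0_abs ?modz_ge0 // eq_sym.
Qed.

Lemma cyclic_shift_mx0 (K : comNzRingType) (k : nat) :
  cyclic_shift_mx K k 0 = 1%:M.
Proof.
apply/matrixP => a b; rewrite !mxE add0r.
have [c ac] := ord_residue k b%:Z (leq_ltn_trans (leq0n a) (ltn_ord a)).
by have := ac b; rewrite subrr dvdz0 ac => /esym/eqP <-.
Qed.

Lemma cyclic_shift_mxD (K : comNzRingType) (k : nat) (m n : int) :
  cyclic_shift_mx K k (m + n) = cyclic_shift_mx K k m *m cyclic_shift_mx K k n.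
Proof.
apply/matrixP => a b; rewrite !mxE.
have [c Hc] := ord_residue k (n + b%:Z) (leq_ltn_trans (leq0n a) (ltn_ord a)).
(* Only the residue c of n + b contributes to the sum over middle indices. *)
rewrite (bigD1 c) //= !mxE Hc eqxx mulr1 big1 ?addr0 => [|d /negPf dc].
  congr (nat_of_bool _)%:R.
  have -> : m + n + b%:Z - a%:Z = (n + b%:Z - c%:Z) + (m + c%:Z - a%:Z) by ring.
  by rewrite rpredDl // Hc.
by rewrite !mxE Hc dc mulr0.
Qed.

Lemma fold_mxEw (K : comNzRingType) (k : nat) (d : {fset int}) (Q : laurent K) :
  (msupp Q `<=` d)%fset ->
  fold_mx K k Q = \sum_(m <- d) Q@_m *: cyclic_shift_mx K k m.
Proof.
by move=> sub; apply: big_fset_incl => // m _ /mcoeff_outdom ->; rewrite scale0r.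
Qed.

Lemma fold_mxU (K : comNzRingType) (k : nat) (c : K) (m : int) :
  fold_mx K k << c *g m >> = c *: cyclic_shift_mx K k m.
Proof. by rewrite (fold_mxEw _ _ _ _ msuppU_le) big_seq_fset1 mcoeffUU. Qed.

Lemma fold_mxD (K : comNzRingType) (k : nat) (P Q : laurent K) :
  fold_mx K k (P + Q) = fold_mx K k P + fold_mx K k Q.
Proof.
rewrite (fold_mxEw _ _ _ _ (msuppD_le P Q)).
rewrite (fold_mxEw _ _ _ P (fsubsetUl _ (msupp Q))).
rewrite (fold_mxEw _ _ _ Q (fsubsetUr (msupp P) _)) -big_split /=.
by apply: eq_bigr => m _; rewrite mcoeffD scalerDl.
Qed.

Lemma fold_mx_sum (K : comNzRingType) (k : nat) (I : Type) (r : seq I)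
    (F : I -> laurent K) :
  fold_mx K k (\sum_(i <- r) F i) = \sum_(i <- r) fold_mx K k (F i).
Proof.
apply: (big_morph (fold_mx K k) (fold_mxD K k)).
by rewrite /fold_mx msupp0 big_seq_fset0.
Qed.

Lemma fold_mxM (K : comNzRingType) (k : nat) (P Q : laurent K) :
  fold_mx K k (P * Q) = fold_mx K k P *m fold_mx K k Q.
Proof.
rewrite [P * Q]/(laurent_mul P Q) /laurent_mul fold_mx_sum mulmx_suml.
apply: eq_bigr => i _; rewrite fold_mx_sum mulmx_sumr; apply: eq_bigr => j _.
by rewrite fold_mxU cyclic_shift_mxD -scalemxAl -scalemxAr scalerA.
Qed.

Lemma fold_mxX (K : comNzRingType) (k : nat) (P : laurent K) (n : nat) :
  fold_mx K k.+1 (P ^+ n) = fold_mx K k.+1 P ^+ n.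
Proof.
elim: n => [|n IHn]; last by rewrite !exprS fold_mxM IHn.
by rewrite !expr0 [1]/(laurent_one K) fold_mxU cyclic_shift_mx0 scale1r.
Qed.

(** The first column of [fold_mx Q] is the image of the class of [1], so it lists
    the coefficients of [Q] reduced modulo [x^k - 1]. *)
Lemma multisectionE (K : comNzRingType) (P : laurent K) (k n : nat) (a : 'I_k.+1) :
  multisection P n k.+1 a = (fold_mx K k.+1 P ^+ n) a ord0.
Proof.
rewrite -fold_mxX summxE.
under [RHS]eq_bigr do rewrite !mxE addr0 mulr_natr mulrb.
rewrite -big_mkcond bigfs ?fset_uniq //=; last by move=> m _ /mcoeff_outdom.
(* The map j |-> (k + 1) * j + a is a bijection onto the class of a. *)
apply/esym/reindex_fsbig; split=> /=.
- by move=> j _ /=; rewrite unfold_in addrK dvdz_mulr.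
- by move=> j l _ _ /addIr/mulfI; apply.
- move=> m /=; rewrite unfold_in => /dvdzP[q mE]; exists q => //.
  by rewrite mulrC -mE subrK.
Qed.

(** * From annihilating polynomials to recurrences and rational functions *)

Lemma horner_mx_coef (K : comNzRingType) (k : nat) (A : 'M[K]_k.+1) (p : {poly K}) :
  horner_mx A p = \sum_(j < size p) p`_j *: A ^+ j.
Proof.
rewrite -[X in horner_mx A X]coefK poly_def rmorph_sum /=.
by apply: eq_bigr => j _; rewrite horner_mxZ rmorphXn /= horner_mx_X.
Qed.

Lemma multisection_recurrence (K : comNzRingType) (P : laurent K) (k : nat)
    (p : {poly K}) (n : nat) (a : 'I_k.+1) :
  horner_mx (fold_mx K k.+1 P) p = 0 ->
  \sum_(j < size p) p`_j * multisection P (n + j) k.+1 a = 0.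
Proof.
move=> Mp0; set M := fold_mx _ _ _ in Mp0.
transitivity ((M ^+ n * horner_mx M p) a ord0); last by rewrite Mp0 mulr0 mxE.
rewrite horner_mx_coef mulr_sumr summxE; apply: eq_bigr => j _.
by rewrite multisectionE -scalerAr mxE -exprD.
Qed.

(** The denominator is the reversal [D] of [q], so that the coefficients of
    [D * f] from index [r + deg q] on are the left-hand sides of the recurrence;
    the earlier ones form the numerator.  The condition on the leading
    coefficient of [q] is the invertibility of [D] as a power series. *)
Lemma rational_of_recurrence (K : fieldType) (f : nat -> K) (q : {poly K})
    (r : nat) :
  lead_coef q != 0 ->
  (forall n, \sum_(j < size q) q`_j * f (n + r + j)%N = 0) ->
  series_eq_ratio f
    (\poly_(n < r + (size q).-1)
       series_mul (series_of_poly (\poly_(i < size q) q`_((size q).-1 - i))) f n)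
    (\poly_(i < size q) q`_((size q).-1 - i)).
Proof.
move=> lq0 recf.
have sq_gt0 : (0 < size q)%N by rewrite lt0n size_poly_eq0 -lead_coef_eq0.
split=> [|n]; first by rewrite coef_poly sq_gt0 subn0 -lead_coefE.
rewrite /series_of_poly coef_poly; case: ltnP => // le_n.
rewrite /series_mul -(subnK le_n).
have idx d j l : (j < d)%N -> (l + (r + d.-1) - j = l + r + (d - j.+1))%N by lia.
(* From index r + deg q on, the coefficient of index N of the product is the
   recurrence at m read backwards. *)
set m := (n - _)%N; set N := (m + _)%N.
rewrite -{}[RHS](recf m) [RHS](reindex_inj rev_ord_inj) /=.
have leN : (size q <= N.+1)%N by rewrite -(prednK sq_gt0) ltnS /N addnA leq_addl.
rewrite (big_ord_widen _ (fun i => q`_(size q - i.+1) *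
  f (m + r + (size q - i.+1))%N) leN) [RHS]big_mkcond /=.
apply: eq_bigr => i _; rewrite coef_poly.
case: ltnP => [lti|_]; last by rewrite mul0r.
congr (q`_ _ * f _); first by rewrite -subn1 -subnDA.
by apply: idx.
Qed.

(** Replacing the factor [X^r] of [p], where [r] is the multiplicity of the root
    [0], by [(X - 1)^r] keeps the degree and removes the root [0]. *)
Lemma nonvanishing_at_0_replacement (K : idomainType) (p : {poly K}) :
  p != 0 ->
  exists (r : nat) (s u : {poly K}),
    [/\ size s = size p, s`_0 != 0 & 'X^r * s = p * u].
Proof.
move=> p_neq0; have [r [q]] := multiplicity_XsubC p 0.
rewrite p_neq0 subr0 /= => q0_neq0 ->.
have q_neq0 : q != 0 by apply: contraNneq q0_neq0 => ->; rewrite root0.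
exists r, (q * ('X - 1) ^+ r), (('X - 1) ^+ r); split; last by ring.
  by rewrite -polyC1 !size_Mmonic ?monic_exp ?monicXsubC ?monicX
    ?size_exp_XsubC ?size_polyXn.
rewrite -horner_coef0 !hornerE mulf_eq0 expf_eq0 negb_or.
by rewrite -rootE q0_neq0 oppr_eq0 oner_eq0 andbF.
Qed.

Theorem mainTheorem1 (R : realType) (P : laurent R[i]) (k : nat)
    (hk : (0 < k)%N) :
  (exists (D : {poly R[i]}) (N : 'I_k -> {poly R[i]}),
     size D = k.+1 /\
     forall a : 'I_k, series_eq_ratio (gen_fun P k a) (N a) D)
  /\
  (exists c : nat -> R[i],
     forall (n : nat) (a : 'I_k),
       multisection P (n + k) k a =
         \sum_(1 <= i < k.+1) c i * multisection P (n + k - i) k a).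
Proof.
case: k hk => // k _; set M := fold_mx R[i] k.+1 P; set p := char_poly M.
have p_sz : size p = k.+2 := size_char_poly M.
have p_lc : p`_k.+1 = 1.
  by rewrite -[k.+1]/(k.+2.-1) -p_sz -lead_coefE (monicP (char_poly_monic M)).
have Mp0 : horner_mx M p = 0 := Cayley_Hamilton M.
split; last first.
  exists (fun i => - p`_(k.+1 - i)) => n a.
  have := multisection_recurrence _ P k p n a Mp0.
  rewrite p_sz big_ord_recr /= p_lc mul1r.
  move=> /eqP; rewrite addrC addr_eq0 => /eqP ->.
  rewrite -sumrN big_add1 /= big_mkord [RHS](reindex_inj rev_ord_inj) /=.
  apply: eq_bigr => j _; have ltj := ltn_ord j.
  by rewrite mulNr; congr (- (p`_ _ * multisection _ _ _ _)); lia.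
have p_neq0 : p != 0 by rewrite -size_poly_eq0 p_sz.
have [r [s [u [s_sz s0 sE]]]] := nonvanishing_at_0_replacement _ p p_neq0.
rewrite p_sz in s_sz.
have s_neq0 : s != 0 by rewrite -size_poly_eq0 s_sz.
have Ms0 : horner_mx M ('X^r * s) = 0 by rewrite sE rmorphM /= Mp0 mul0r.
exists (\poly_(i < size s) s`_((size s).-1 - i)).
eexists; split; first by rewrite size_poly_eq s_sz //= subnn.
move=> a; apply: (rational_of_recurrence _ _ s r).
  by rewrite lead_coef_eq0.
move=> n; have := multisection_recurrence _ P k ('X^r * s) n a Ms0.
(* The r lowest coefficients of 'X^r * s vanish, which delays the recurrence of
   s by r. *)
rewrite size_monicM ?monicXn // size_polyXn addSn /= big_split_ord /=.
rewrite big1 => [|i _]; last by rewrite coefXnM ltn_ord mul0r.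
rewrite add0r => sum0; rewrite -[RHS]sum0; apply: eq_bigr => j _.
by rewrite /gen_fun coefXnM ltnNge leq_addr /= addKn addnA.
Qed.
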